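(* Let $\mathbb{F}$ be an algebraically closed field of characteristic $\neq 2$. Any nilpotent Jordan algebra of dimension four over $\mathbb{F}$ is isomorphic to one of the following pairwise non-isomorphic algebras (each with basis $a,b,c,d$; only the non-zero products of basis elements are listed, up to commutativity): - $J_{4,1}$: all products zero (associative). - $J_{4,2}: a^{2}=b$ (associative). - $J_{4,3}: a\circ b=c$ (associative). - $J_{4,4}: a^{2}=b,\ a\circ b=c$ (associative). - $J_{4,5}: a\circ b=d,\ c^{2}=d$ (associative). - $J_{4,6}: a^{2}=b,\ b\circ c=d$ (non-associative). - $J_{4,7}: a^{2}=b,\ a\circ b=d,\ c^{2}=d$ (associative). - $J_{4,8}: a\circ b=c,\ a\circ c=d$ (non-associative). - $J_{4,9}: a\circ b=c,\ a\circ c=d,\ b^{2}=d$ (non-associative). - $J_{4,10}: a\circ b=c,\ a\circ c=d,\ b\circ c=d$ (non-associative). - $J_{4,11}: a^{2}=b,\ a\circ b=c,\ a\circ c=d,\ b^{2}=d$ (associative). - $J_{4,12}: a^{2}=c,\ a\circ b=d$ (associative). - $J_{4,13}: a^{2}=c,\ b^{2}=d$ (associative).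
   Context: A Jordan algebra over a field $\mathbb{F}$ is a commutative (not necessarily associative) $\mathbb{F}$-algebra $J$ with multiplication $\circ$ satisfying $x^{2}\circ(x\circ y)=x\circ(x^{2}\circ y)$ for all $x,y\in J$, where $x^2=x\circ x$. Put $J^{\langle 1\rangle}=J$ and $J^{\langle n\rangle}=J^{\langle n-1\rangle}\circ J$ (linear span of products); $J$ is nilpotent if $J^{\langle n\rangle}=0$ for some $n$. ''Non-associative'' means ''not associative''. Products of basis elements not listed, and not obtained by commutativity, are zero. *)

(* Defs.v *)
From HB Require Import structures.
From mathcomp Require Import all_boot all_order all_algebra.

Set Implicit Arguments.
Unset Strict Implicit.
Unset Printing Implicit Defensive.

Import GRing.Theory.
Local Open Scope ring_scope.

(* A (not necessarily associative) finite-dimensional F-algebra is a vector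
   space V : vectType F together with a bilinear product on it. *)

Section Algebra.

Variables (F : fieldType) (V : vectType F).
Implicit Types (m : {bilinear V -> V -> V}) (U W X : {vspace V}).

Definition is_jordan m : Prop :=
  (forall x y, m x y = m y x) /\
  (forall x y, m (m x x) (m x y) = m x (m (m x x) y)).

Definition is_assoc m : Prop :=
  forall x y z, m x (m y z) = m (m x y) z.

(* The linear span of all products m u w with u in U and w in W; by
   bilinearity bases of U and W suffice (lemmas mem_prodsp and prodspP). *)
Definition prodsp m U W : {vspace V} :=
  <<[seq m u w | u <- vbasis U, w <- vbasis W]>>%VS.

Lemma mem_prodsp m U W u w :
  u \in U -> w \in W -> m u w \in prodsp m U W.
Proof.
move=> /coord_vbasis-> /coord_vbasis->.
rewrite linear_sumlz memv_suml // => i _; rewrite linear_sumr memv_suml // => j _.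
rewrite linearZl_LR linearZr_LR !memvZ // memv_span //.
by apply/allpairs_f; rewrite memt_nth.
Qed.

Lemma prodspP m U W X :
  reflect (forall u w, u \in U -> w \in W -> m u w \in X)
          (prodsp m U W <= X)%VS.
Proof.
apply: (iffP idP) => [sX u w uU wW | H].
  exact: (subvP sX) (mem_prodsp m uU wW).
apply/span_subvP => _ /allpairsP[[u w] /= [uU wW ->]].
by apply: H; apply: vbasis_mem.
Qed.

(* J^<1> = J and J^<n> = J^<n-1> o J for n >= 2.  The index 0 is not used in
   the source; the value J^<0> = J given here does not affect nilpotency. *)
Definition jpower m (n : nat) : {vspace V} :=
  iter n.-1 (fun U => prodsp m U fullv) fullv.

Definition is_nilpotent m : Prop := exists n, jpower m n = 0%VS.

End Algebra.

Definition isomorphic (F : fieldType) (V W : vectType F)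
    (mV : {bilinear V -> V -> V}) (mW : {bilinear W -> W -> W}) : Prop :=
  exists f : {linear V -> W},
    bijective f /\ forall x y, f (mV x y) = mW (f x) (f y).

(* The algebra J_{4,n}, for 1 <= n <= 13, is realized on 'rV[F]_4, with
   a, b, c, d the standard basis vectors e_0, e_1, e_2, e_3.  An entry
   (p, q, r) of the table means that e_p o e_q = e_q o e_p = e_r; products
   without an entry are zero. *)
Definition J4_table (n : nat) : seq ('I_4 * 'I_4 * 'I_4) :=
  let a := @Ordinal 4 0 isT in let b := @Ordinal 4 1 isT in
  let c := @Ordinal 4 2 isT in let d := @Ordinal 4 3 isT in
  match n with
  | 1 => [::]
  | 2 => [:: (a, a, b)]
  | 3 => [:: (a, b, c)]
  | 4 => [:: (a, a, b); (a, b, c)]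
  | 5 => [:: (a, b, d); (c, c, d)]
  | 6 => [:: (a, a, b); (b, c, d)]
  | 7 => [:: (a, a, b); (a, b, d); (c, c, d)]
  | 8 => [:: (a, b, c); (a, c, d)]
  | 9 => [:: (a, b, c); (a, c, d); (b, b, d)]
  | 10 => [:: (a, b, c); (a, c, d); (b, c, d)]
  | 11 => [:: (a, a, b); (a, b, c); (a, c, d); (b, b, d)]
  | 12 => [:: (a, a, c); (a, b, d)]
  | 13 => [:: (a, a, c); (b, b, d)]
  | _ => [::]
  end.

Section J4.

Variables (F : fieldType) (n : nat).

Definition J4_basis_mul (p q : 'I_4) : 'rV[F]_4 :=
  \sum_(t <- J4_table n | (t.1 == (p, q)) || (t.1 == (q, p))) delta_mx 0 t.2.

Definition J4 (x y : 'rV[F]_4) : 'rV[F]_4 :=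
  \sum_(p < 4) \sum_(q < 4) (x 0 p * y 0 q) *: J4_basis_mul p q.

Fact J4_is_bilinear : bilinear_for *:%R *:%R J4.
Proof.
split=> [y k x x' | x k y y'] /=; rewrite /J4 scaler_sumr -big_split /=;
  apply: eq_bigr => p _; rewrite scaler_sumr -big_split /=;
  apply: eq_bigr => q _; rewrite !mxE scalerA -scalerDl; congr (_ *: _).
  by rewrite mulrDl mulrA.
by rewrite mulrDr mulrCA.
Qed.

HB.instance Definition _ := bilinear_isBilinear.Build F
  'rV[F]_4 'rV[F]_4 'rV[F]_4 *:%R *:%R J4 J4_is_bilinear.

Lemma J4_delta p q :
  J4 (delta_mx 0 p) (delta_mx 0 q) = J4_basis_mul p q.
Proof.
rewrite /J4 (bigD1 p) //= (bigD1 q) //= !mxE !eqxx mulr1 scale1r.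
rewrite !big1 ?addr0 // => [p' /negPf np | q' /negPf nq].
  by rewrite big1 // => q' _; rewrite !mxE np andbF mul0r scale0r.
by rewrite !mxE nq andbF mulr0 scale0r.
Qed.

End J4.

Arguments J4 : clear implicits.

(* Main.v *)
Require Import Defs.
From HB Require Import structures.
From mathcomp Require Import all_boot all_order all_algebra.
From mathcomp Require Import ring zify.
Import GRing.Theory.
Local Open Scope ring_scope.

Set Implicit Arguments.
Unset Strict Implicit.
Unset Printing Implicit Defensive.

(* A nilpotent J of dimension 4 has J^<n+1> strictly inside J^<n>.  If
   dim J^<2> = 3, then J is generated by any a outside J^<2>, and the Jordan
   identity forces the table of J_{4,11} in the basis a, a^2, a^2 a, (a^2 a) a.
   Otherwise J^<4> = 0, and a basis a, b, c, d adapted to the flag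
   J^<3> <= J^<2> makes d central and puts the products of a and b in <c, d>
   and the products with c in <d>; the Jordan identity then kills c^2 unless
   J^<2> <= <d>.  Bringing the binary form given by the c-coordinates of a^2,
   ab, b^2 to one of 0, x^2, 2xy (or, when it vanishes, the ternary form with
   values in <d>) leaves a short list of cases, each of which is matched with
   the table by an explicit change of basis.  The algebras of the table are
   separated by first-order properties of the product, which are invariant
   under isomorphism. *)

(** * Coordinates *)

Section Coordinates.

Variable F : fieldType.

Definition vec (x0 x1 x2 x3 : F) : 'rV[F]_4 :=
  \row_(i < 4) nth 0 [:: x0; x1; x2; x3] i.

Lemma vec_ind (P : 'rV[F]_4 -> Prop) :
  (forall x0 x1 x2 x3, P (vec x0 x1 x2 x3)) -> forall v, P v.
Proof.
move=> Pvec v.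
suff -> : v = vec (v 0 0) (v 0 1) (v 0 (inord 2)) (v 0 (inord 3)) by apply: Pvec.
apply/rowP => i; rewrite mxE.
by case: i => [[|[|[|[|//]]]] ilt] /=; congr (v 0 _); apply/val_inj; rewrite /= ?inordK.
Qed.

Lemma vec_inj x0 x1 x2 x3 y0 y1 y2 y3 :
  vec x0 x1 x2 x3 = vec y0 y1 y2 y3 -> [/\ x0 = y0, x1 = y1, x2 = y2 & x3 = y3].
Proof.
move=> /rowP eqv; split.
- by have := eqv (@Ordinal 4 0 isT); rewrite !mxE.
- by have := eqv (@Ordinal 4 1 isT); rewrite !mxE.
- by have := eqv (@Ordinal 4 2 isT); rewrite !mxE.
- by have := eqv (@Ordinal 4 3 isT); rewrite !mxE.
Qed.

Lemma vec0 : 0 = vec 0 0 0 0.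
Proof. by apply/rowP => i; rewrite !mxE; case: i => [[|[|[|[|//]]]] ilt]. Qed.

Lemma vecD x0 x1 x2 x3 y0 y1 y2 y3 :
  vec x0 x1 x2 x3 + vec y0 y1 y2 y3 = vec (x0 + y0) (x1 + y1) (x2 + y2) (x3 + y3).
Proof. by apply/rowP => i; rewrite !mxE; case: i => [[|[|[|[|//]]]] ilt]. Qed.

Lemma vecZ k x0 x1 x2 x3 :
  k *: vec x0 x1 x2 x3 = vec (k * x0) (k * x1) (k * x2) (k * x3).
Proof. by apply/rowP => i; rewrite !mxE; case: i => [[|[|[|[|//]]]] ilt]. Qed.

(** Exchange the sum over pairs of basis vectors with the sum over table entries: an entry (p, q, r)
    is met by the pairs (p, q) and (q, p), which coincide when p = q. *)
Lemma J4_sum_table n (x y : 'rV[F]_4) :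
  J4 F n x y = \sum_(t <- J4_table n)
    (if t.1.1 == t.1.2 then x 0 t.1.1 * y 0 t.1.1
     else x 0 t.1.1 * y 0 t.1.2 + x 0 t.1.2 * y 0 t.1.1) *: delta_mx 0 t.2.
Proof.
rewrite /J4 pair_bigA /= /J4_basis_mul.
under eq_bigr => u _ do rewrite scaler_sumr big_mkcond /=.
rewrite exchange_big /=; apply: eq_bigr => -[[p q] r] _ /=.
rewrite -big_mkcond -scaler_suml /=; congr (_ *: _).
have [<-{q} | neqpq] := eqVneq p q.
  rewrite (big_pred1 (p, p)) // => -[p' q'] /=.
  by rewrite !xpair_eqE !(eq_sym p) [X in _ || X]andbC orbb.
rewrite (bigD1 (p, q)) /= ?eqxx //; congr (_ + _).
rewrite (big_pred1 (q, p)) // => -[p' q'] /=.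
rewrite !xpair_eqE !(eq_sym p) !(eq_sym q).
have [-> | _] := eqVneq p' p; have [-> | _] := eqVneq q' q;
  rewrite ?(negPf neqpq) ?[q == p]eq_sym ?(negPf neqpq) ?andbF ?orbF ?andbT //=.
exact: andbC.
Qed.

(** Closed coordinate formulas let [ring] decide identities in the table; the default branch covers
    n = 1 and the indices outside the table. *)
Definition J4_coord n (x0 x1 x2 x3 y0 y1 y2 y3 : F) : 'rV[F]_4 :=
  match n with
  | 2 => vec 0 (x0 * y0) 0 0
  | 3 => vec 0 0 (x0 * y1 + x1 * y0) 0
  | 4 => vec 0 (x0 * y0) (x0 * y1 + x1 * y0) 0
  | 5 => vec 0 0 0 (x0 * y1 + x1 * y0 + x2 * y2)
  | 6 => vec 0 (x0 * y0) 0 (x1 * y2 + x2 * y1)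
  | 7 => vec 0 (x0 * y0) 0 (x0 * y1 + x1 * y0 + x2 * y2)
  | 8 => vec 0 0 (x0 * y1 + x1 * y0) (x0 * y2 + x2 * y0)
  | 9 => vec 0 0 (x0 * y1 + x1 * y0) (x0 * y2 + x2 * y0 + x1 * y1)
  | 10 => vec 0 0 (x0 * y1 + x1 * y0) (x0 * y2 + x2 * y0 + x1 * y2 + x2 * y1)
  | 11 => vec 0 (x0 * y0) (x0 * y1 + x1 * y0) (x0 * y2 + x2 * y0 + x1 * y1)
  | 12 => vec 0 0 (x0 * y0) (x0 * y1 + x1 * y0)
  | 13 => vec 0 0 (x0 * y0) (x1 * y1)
  | _ => vec 0 0 0 0
  end.

Lemma J4_vec n x0 x1 x2 x3 y0 y1 y2 y3 :
  J4 F n (vec x0 x1 x2 x3) (vec y0 y1 y2 y3) =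
  J4_coord n x0 x1 x2 x3 y0 y1 y2 y3.
Proof.
rewrite J4_sum_table.
do 14?[case: n => [|n]]; rewrite /= ?big_cons ?big_nil /=;
  apply/rowP => k; rewrite !mxE;
  case: k => [[|[|[|[|//]]]] klt] /=; ring.
Qed.

End Coordinates.

(** * The algebras of the table *)

Section Nilpotency.

Variables (F : fieldType) (V : vectType F) (m : {bilinear V -> V -> V}).

(** An elementwise form of nilpotency, checked by computing with vectors rather than with spans of
    products. *)
Fixpoint right_annihilated k (u : V) : Prop :=
  if k is k'.+1 then forall w, right_annihilated k' (m u w) else u = 0.

Lemma right_annihilated_linear k a u v :
  right_annihilated k u -> right_annihilated k v ->
  right_annihilated k (a *: u + v).
Proof.
elim: k u v => [|k IHk] u v /=; first by move=> -> ->; rewrite scaler0 addr0.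
by move=> nu nv w; rewrite linearDl linearZl_LR; apply: IHk.
Qed.

Lemma right_annihilated0 k : right_annihilated k 0.
Proof. by elim: k => [|k IHk] //= w; rewrite linear0l. Qed.

Lemma right_annihilated_prodsp k (U W : {vspace V}) :
  (forall u, u \in U -> right_annihilated k.+1 u) ->
  forall u, u \in prodsp m U W -> right_annihilated k u.
Proof.
move=> nU u /(@coord_span _ _ _ (in_tuple _)) ->.
elim/big_rec: _ => [|i v _ nv]; first exact: right_annihilated0.
apply: right_annihilated_linear => //.
set X := in_tuple _; have /allpairsP[[x y] /= [xU _ ->]] : X`_i \in X by apply: mem_nth.
exact: (nU _ (vbasis_mem xU)).
Qed.

Lemma right_annihilated_nilpotent k :
  (forall u, right_annihilated k u) -> is_nilpotent m.
Proof.
move=> nk; exists k.+1; apply/eqP; rewrite -subv0; apply/subvP => u.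
(* Elements of J^<j+1> die after k - j more right multiplications; j = k gives J^<k+1> = 0. *)
suff P j : (j <= k)%N ->
    forall u, u \in jpower m j.+1 -> right_annihilated (k - j) u.
  by move/(P k (leqnn k)); rewrite subnn /= => ->; rewrite mem0v.
elim: j => [|j IHj] ltjk {}u; first by rewrite subn0.
apply: right_annihilated_prodsp => v /IHj.
by rewrite subnSK //; apply; apply: ltnW.
Qed.

End Nilpotency.

Ltac case_index n := do 14?[case: n => [|n] //].

Lemma J4_jordan (F : fieldType) n : (1 <= n <= 13)%N -> is_jordan (J4 F n).
Proof.
case_index n => _; split=> x y; elim/vec_ind: x => x0 x1 x2 x3;
  elim/vec_ind: y => y0 y1 y2 y3; rewrite /= !J4_vec /= ?J4_vec /= ?J4_vec /=;
  congr vec; ring.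
Qed.

Lemma J4_nilpotent (F : fieldType) n : (1 <= n <= 13)%N -> is_nilpotent (J4 F n).
Proof.
(* Three right multiplications are too few: ((aa)a)a = d in J_{4,11}. *)
move=> len; apply: (@right_annihilated_nilpotent _ _ _ 4) => x y z t w.
elim/vec_ind: x => x0 x1 x2 x3; elim/vec_ind: y => y0 y1 y2 y3.
elim/vec_ind: z => z0 z1 z2 z3; elim/vec_ind: t => t0 t1 t2 t3.
elim/vec_ind: w => w0 w1 w2 w3; rewrite /= vec0.
move: len; case_index n => _; rewrite /=; do 4!rewrite J4_vec /=; congr vec; ring.
Qed.

Lemma J4_assoc (F : fieldType) n :
  n \in [:: 1; 2; 3; 4; 5; 7; 11; 12; 13]%N -> is_assoc (J4 F n).
Proof.
move=> inn x y z; elim/vec_ind: x => x0 x1 x2 x3.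
elim/vec_ind: y => y0 y1 y2 y3; elim/vec_ind: z => z0 z1 z2 z3.
by move: inn; case_index n => _; rewrite /=; do 4!rewrite ?J4_vec /=; congr vec; ring.
Qed.

Lemma J4_not_assoc (F : fieldType) n :
  n \in [:: 6; 8; 9; 10]%N -> ~ is_assoc (J4 F n).
Proof.
pose a : 'rV[F]_4 := vec 1 0 0 0; pose b : 'rV[F]_4 := vec 0 1 0 0; pose c : 'rV[F]_4 := vec 0 0 1 0.
(* In J_{4,6}, c(aa) = d and (ca)a = 0; in the other three, b(aa) = 0 and (ba)a = d. *)
move=> + /(_ (if n == 6%N then c else b) a a).
case_index n => _; rewrite /= ?J4_vec /= ?J4_vec /= => /vec_inj[_ _ _ /eqP];
  rewrite ?(mul0r, mulr0, mul1r, add0r, addr0) ?(eq_sym 0) oner_eq0 //.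
Qed.

(** * Isomorphism invariants *)

Section Isomorphism.

Variable F : fieldType.
Implicit Types U V W : vectType F.

Lemma isomorphic_sym V W (mV : {bilinear V -> V -> V}) (mW : {bilinear W -> W -> W}) :
  isomorphic mV mW -> isomorphic mW mV.
Proof.
case=> f [[g fK gK] fM].
have g_linear : linear g by apply: can2_linear fK gK.
pose gL := GRing.isLinear.Build F W V *:%R g g_linear.
pose G : {linear W -> V} := HB.pack g gL.
exists G; split; first by exists f.
by move=> x y; apply: (can_inj fK); rewrite fM !gK.
Qed.

Lemma isomorphic_trans U V W (mU : {bilinear U -> U -> U})
    (mV : {bilinear V -> V -> V}) (mW : {bilinear W -> W -> W}) :
  isomorphic mU mV -> isomorphic mV mW -> isomorphic mU mW.
Proof.
case=> f [bij_f fM] [g [bij_g gM]]; exists (g \o f)%FUN; split=> [|x y /=].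
  exact: bij_comp.
by rewrite fM gM.
Qed.

Definition isomorphism_invariant
    (P : forall V, {bilinear V -> V -> V} -> Prop) : Prop :=
  forall V W (mV : {bilinear V -> V -> V}) (mW : {bilinear W -> W -> W}),
    isomorphic mV mW -> (P V mV <-> P W mW).

(** Symmetry of isomorphism leaves one implication. Surjectivity becomes an induction principle and
    injectivity a rewriting rule for [== 0], which is why the invariants below are stated through
    [== 0]. *)
Lemma isomorphism_invariantI (P : forall V, {bilinear V -> V -> V} -> Prop) :
  (forall V W (mV : {bilinear V -> V -> V}) (mW : {bilinear W -> W -> W})
      (f : {linear V -> W}),
    (forall Q : W -> Prop, (forall x, Q (f x)) -> forall y, Q y) ->
    (forall x, (f x == 0) = (x == 0)) ->
    (forall x y, mW (f x) (f y) = f (mV x y)) -> P V mV -> P W mW) ->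
  isomorphism_invariant P.
Proof.
move=> transP.
suff P_iso V W (mV : {bilinear V -> V -> V}) (mW : {bilinear W -> W -> W}) :
    isomorphic mV mW -> P V mV -> P W mW.
  by move=> V W mV mW isoVW; split; apply: P_iso => //; apply: isomorphic_sym.
case=> f [[g fK gK] fM]; apply: (transP _ _ _ _ f) => [Q Qf y | x | x y].
- by rewrite -(gK y).
- by rewrite raddf_eq0 //; apply: can_inj fK.
- by rewrite fM.
Qed.

End Isomorphism.

Section Invariants.

Variables (F : fieldType) (V : vectType F) (m : {bilinear V -> V -> V}).

(** In the names below, x is isotropic when x^2 = 0, vectors are orthogonal when their product is
    zero, and a vector is central when it annihilates the algebra. *)
Definition null_product : Prop := forall x y, m x y == 0.
Definition null_cube : Prop := forall x y z, m (m x y) z == 0.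
Definition null_fourth : Prop := forall x y z w, m (m (m x y) z) w == 0.
Definition null_associators : Prop := forall x y z, m x (m y z) - m (m x y) z == 0.
Definition anisotropic_killing_square : Prop :=
  exists2 x, m x x != 0 & forall y z, m x (m y z) == 0.
Definition isotropic_central : Prop := forall x y, m x x == 0 -> m x y == 0.
Definition orthogonal_anisotropic : Prop :=
  exists x y, [/\ m x y == 0, m x x != 0 & m y y != 0].
Definition anisotropic_orthogonal_isotropic : Prop :=
  exists x y w, [/\ m x x != 0, m x y == 0, m y y == 0 & m y w != 0].
Definition central_square_second_center : Prop :=
  forall x y z, (forall w, m (m x x) w == 0) -> m (m x y) z == 0.
Definition isotropic_killing_square : Prop :=
  exists v x y, [/\ m v v == 0, m (m v x) y != 0 & forall z w, m (m z w) v == 0].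
Definition isotropic_triple_product : Prop :=
  exists u v w, [/\ m u u == 0, m v v == 0 & m (m u v) w != 0].

End Invariants.

Section Invariance.

Variable F : fieldType.

Local Ltac transport :=
  let f_ind := fresh "f_ind" in
  let f0 := fresh "f0" in let fM := fresh "fM" in
  apply: isomorphism_invariantI => V W mV mW f f_ind f0 fM.

Lemma null_product_invariant : isomorphism_invariant (@null_product F).
Proof.
by transport=> H; do 2!elim/f_ind=> ?; rewrite !fM f0.
Qed.

Lemma null_cube_invariant : isomorphism_invariant (@null_cube F).
Proof. by transport=> H; do 3!elim/f_ind=> ?; rewrite !fM f0. Qed.

Lemma null_fourth_invariant : isomorphism_invariant (@null_fourth F).
Proof. by transport=> H; do 4!elim/f_ind=> ?; rewrite !fM f0. Qed.

Lemma null_associators_invariant : isomorphism_invariant (@null_associators F).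
Proof. by transport=> H; do 3!elim/f_ind=> ?; rewrite !fM -raddfB f0. Qed.

Lemma anisotropic_killing_square_invariant :
  isomorphism_invariant (@anisotropic_killing_square F).
Proof.
transport=> -[x x2 Hx]; exists (f x); first by rewrite fM f0.
by do 2!elim/f_ind=> ?; rewrite !fM f0.
Qed.

Lemma isotropic_central_invariant : isomorphism_invariant (@isotropic_central F).
Proof. by transport=> H; do 2!elim/f_ind=> ?; rewrite !fM !f0; apply: H. Qed.

Lemma orthogonal_anisotropic_invariant :
  isomorphism_invariant (@orthogonal_anisotropic F).
Proof. by transport=> -[x [y H]]; exists (f x), (f y); rewrite !fM !f0. Qed.

Lemma anisotropic_orthogonal_isotropic_invariant :
  isomorphism_invariant (@anisotropic_orthogonal_isotropic F).
Proof.
by transport=> -[x [y [w H]]]; exists (f x), (f y), (f w); rewrite !fM !f0.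
Qed.

Lemma central_square_second_center_invariant :
  isomorphism_invariant (@central_square_second_center F).
Proof.
transport=> H; elim/f_ind=> x; do 2!elim/f_ind=> ?; rewrite !fM f0 => Hx.
by apply: H => w; have := Hx (f w); rewrite fM f0.
Qed.

Lemma isotropic_killing_square_invariant :
  isomorphism_invariant (@isotropic_killing_square F).
Proof.
transport=> -[v [x [y [v2 vxy Hv]]]]; exists (f v), (f x), (f y).
by rewrite !fM !f0; split=> //; do 2!elim/f_ind=> ?; rewrite !fM f0.
Qed.

Lemma isotropic_triple_product_invariant :
  isomorphism_invariant (@isotropic_triple_product F).
Proof.
by transport=> -[x [y [w H]]]; exists (f x), (f y), (f w); rewrite !fM !f0.
Qed.

End Invariance.

(** * Separation of the thirteen algebras *)

Section Separation.

Variable F : fieldType.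
Hypothesis char_neq2 : (2%:R : F) != 0.

Let a : 'rV[F]_4 := vec 1 0 0 0.
Let b : 'rV[F]_4 := vec 0 1 0 0.
Let c : 'rV[F]_4 := vec 0 0 1 0.

Lemma vec_eq0 (x0 x1 x2 x3 : F) :
  (vec x0 x1 x2 x3 == 0) = [&& x0 == 0, x1 == 0, x2 == 0 & x3 == 0].
Proof.
apply/eqP/and4P => [|[/eqP-> /eqP-> /eqP-> /eqP->]]; last by rewrite -vec0.
by rewrite vec0 => /vec_inj[-> -> -> ->].
Qed.

Lemma double_eq0 (x y : F) : (x * y + y * x == 0) = (x == 0) || (y == 0).
Proof. by rewrite (mulrC y) -mulr2n -mulr_natl !mulf_eq0 (negPf char_neq2). Qed.

Local Ltac eval_J4 :=
  rewrite /a /b /c /= ?J4_vec /= ?J4_vec /= ?J4_vec /= ?vec_eq0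
    ?(mulr0, mul0r, mulr1, mul1r, addr0, add0r, eqxx, andbT, oner_eq0) /=.

Lemma null_product_J4 n : (1 <= n <= 13)%N -> null_product (J4 F n) <-> n == 1%N.
Proof.
move=> len; split.
  move=> /(_ a (if n \in [:: 3; 5; 8; 9; 10]%N then b else a)).
  by move: len; case_index n => _; eval_J4.
move=> /eqP-> x y; elim/vec_ind: x => x0 x1 x2 x3.
by elim/vec_ind: y => y0 y1 y2 y3; eval_J4.
Qed.

Lemma null_cube_J4 n : (1 <= n <= 13)%N ->
  null_cube (J4 F n) <-> n \in [:: 1; 2; 3; 5; 12; 13]%N.
Proof.
move=> len; split.
  move=> /(_ a (if n \in [:: 8; 9; 10]%N then b else a) (if n == 6%N then c else a)).
  by move: len; case_index n => _; eval_J4.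
move=> inn x y z; elim/vec_ind: x => x0 x1 x2 x3.
elim/vec_ind: y => y0 y1 y2 y3; elim/vec_ind: z => z0 z1 z2 z3.
by move: len inn; case_index n => _ _; eval_J4.
Qed.

Lemma null_fourth_J4 n : (1 <= n <= 13)%N -> null_fourth (J4 F n) <-> n != 11%N.
Proof.
move=> len; split.
  by move=> H; apply/eqP => n11; have := H a a a a; rewrite n11; eval_J4.
move=> inn x y z t; elim/vec_ind: x => x0 x1 x2 x3.
elim/vec_ind: y => y0 y1 y2 y3; elim/vec_ind: z => z0 z1 z2 z3.
elim/vec_ind: t => t0 t1 t2 t3.
by move: len inn; case_index n => _ _; eval_J4.
Qed.

Lemma null_associators_J4 n : (1 <= n <= 13)%N ->
  null_associators (J4 F n) <-> n \notin [:: 6; 8; 9; 10]%N.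
Proof.
move=> len; split=> [H|inn x y z].
  apply/negP => /J4_not_assoc; apply=> x y z; apply/eqP.
  by rewrite -subr_eq0; apply: H.
rewrite subr_eq0; apply/eqP; apply: J4_assoc.
by move: len inn; case_index n.
Qed.

(** In J_{4,4}, x a^2 = 0 kills the a-coordinate of x, hence x^2; in J_{4,7}, c kills all products
    although c^2 = d. *)
Lemma anisotropic_killing_square_J4 n : n \in [:: 4; 7]%N ->
  anisotropic_killing_square (J4 F n) <-> n == 7%N.
Proof.
move=> len; split.
  move: len; case_index n => _ -[x]; elim/vec_ind: x => x0 x1 x2 x3.
  move=> + /(_ a a); eval_J4 => /negP x2_neq0 x0_eq0; case: x2_neq0.
  by rewrite (eqP x0_eq0) !(mul0r, mulr0) addr0 eqxx.
move=> /eqP->; exists c; first by eval_J4.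
move=> y z; elim/vec_ind: y => y0 y1 y2 y3; elim/vec_ind: z => z0 z1 z2 z3.
by eval_J4.
Qed.

Lemma isotropic_central_J4 n : n \in [:: 2; 3; 5; 12; 13]%N ->
  isotropic_central (J4 F n) <-> n \in [:: 2; 13]%N.
Proof.
move=> len; split.
  move=> /(_ (if n == 12%N then b else a) (if n == 12%N then a else b)).
  by move: len; case_index n => _; eval_J4 => // /(_ isT).
move=> inn x y; elim/vec_ind: x => x0 x1 x2 x3; elim/vec_ind: y => y0 y1 y2 y3.
move: len inn; case_index n => _ _; eval_J4; rewrite !mulf_eq0 ?orbb.
  by move=> ->.
by case/andP=> -> ->.
Qed.

Lemma orthogonal_anisotropic_J4 n : n \in [:: 2; 3; 5; 12; 13]%N ->
  orthogonal_anisotropic (J4 F n) <-> n \in [:: 3; 5; 13]%N.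
Proof.
move=> len; split.
  case=> x [y]; elim/vec_ind: x => x0 x1 x2 x3; elim/vec_ind: y => y0 y1 y2 y3.
  move: len; case_index n => _; eval_J4; rewrite !mulf_eq0 ?double_eq0 ?orbb.
    by case=> /orP[]->.
  by case=> /andP[/orP[]->].
move=> inn.
(* In J_{4,3} and J_{4,5}, (a + b)(a - b) = a^2 - b^2 = 0, while the squares of a + b and a - b are
   2ab and -2ab. *)
exists (if n == 13%N then a else vec 1 1 0 0).
exists (if n == 13%N then b else vec 1 (-1) 0 0).
move: len inn; case_index n => _ _; eval_J4;
  rewrite ?mulN1r ?mulrN1 ?addNr ?eqxx -?opprD ?oppr_eq0 -?(natrD _ 1 1) //.
Qed.

(** J_{4,3} is a hyperbolic plane plus a radical, where only isotropic vectors are orthogonal to an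
    isotropic vector outside the radical; in J_{4,5}, c is orthogonal to a. *)
Lemma anisotropic_orthogonal_isotropic_J4 n : n \in [:: 3; 5]%N ->
  anisotropic_orthogonal_isotropic (J4 F n) <-> n == 5%N.
Proof.
move=> len; split.
  case=> x [y [w]]; elim/vec_ind: x => x0 x1 x2 x3.
  elim/vec_ind: y => y0 y1 y2 y3; elim/vec_ind: w => w0 w1 w2 w3.
  move: len; case_index n => _; eval_J4; rewrite !double_eq0 negb_or.
  case=> /andP[/negPf x0N /negPf x1N] xy /orP[] /eqP y_eq0; move: xy; rewrite y_eq0;
    by rewrite !(mul0r, mulr0, addr0, add0r) mulf_eq0 ?x0N ?x1N /= => /eqP->;
       rewrite mul0r eqxx.
by move=> /eqP->; exists c, a, b; eval_J4.
Qed.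

(** In J_{4,6}, x^2 c = 0 kills the a-coordinate of x, so xy lies in <d>. In the others a^2 = 0 but
    (ab)a = d. *)
Lemma central_square_second_center_J4 n : n \in [:: 6; 8; 9; 10]%N ->
  central_square_second_center (J4 F n) <-> n == 6%N.
Proof.
move=> len; split.
  move=> /(_ a b a); move: len; case_index n => _; eval_J4 => //;
    by move=> H; suff: false by []; apply: H => w; elim/vec_ind: w => w0 w1 w2 w3; eval_J4.
move=> /eqP-> x y z; elim/vec_ind: x => x0 x1 x2 x3.
elim/vec_ind: y => y0 y1 y2 y3; elim/vec_ind: z => z0 z1 z2 z3.
move/(_ c); eval_J4; rewrite !mulf_eq0 orbb.
by move=> ->.
Qed.

(** In J_{4,9} and J_{4,10}, v^2 = 0 and (ab)v = cv = 0 force v into <c, d>, so (vx)y = 0; in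
    J_{4,8}, v = b works. *)
Lemma isotropic_killing_square_J4 n : n \in [:: 8; 9; 10]%N ->
  isotropic_killing_square (J4 F n) <-> n == 8%N.
Proof.
move=> len; split.
  case=> v [x [y]]; elim/vec_ind: v => v0 v1 v2 v3.
  elim/vec_ind: x => x0 x1 x2 x3; elim/vec_ind: y => y0 y1 y2 y3.
  move: len; case_index n => _ -[+ + /(_ a b)]; eval_J4; rewrite !double_eq0.
    move=> + /negP vxy /eqP v00; rewrite v00 !(mul0r, mulr0, add0r) mulf_eq0 orbb eqxx /=.
    by move=> /eqP v10; case: vxy; rewrite v00 v10 !(mul0r, mulr0, add0r).
  move=> + /negP vxy; move=> /andP[v01 _]; rewrite addr_eq0 => v0N1; case: vxy.
  have v10 : v1 = 0.
    by move: v01 v0N1 => /orP[/eqP-> | /eqP //]; rewrite eq_sym oppr_eq0 => /eqP.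
  by move: v0N1; rewrite v10 oppr0 => /eqP->; rewrite !(mul0r, mulr0, add0r).
move=> /eqP->; exists b, a, a; split; [by eval_J4 | by eval_J4 |] => z w.
by elim/vec_ind: z => z0 z1 z2 z3; elim/vec_ind: w => w0 w1 w2 w3; eval_J4.
Qed.

(** In J_{4,9} isotropic vectors have no b-coordinate, so two of them multiply into <d>. *)
Lemma isotropic_triple_product_J4 n : n \in [:: 9; 10]%N ->
  isotropic_triple_product (J4 F n) <-> n == 10%N.
Proof.
move=> len; split; last by move=> /eqP->; exists a, b, a; eval_J4.
case=> u [v [w]]; elim/vec_ind: u => u0 u1 u2 u3.
elim/vec_ind: v => v0 v1 v2 v3; elim/vec_ind: w => w0 w1 w2 w3.
move: len; case_index n => _; eval_J4; rewrite !double_eq0.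
have iso (x y z : F) :
    ((x == 0) || (y == 0)) && (x * z + z * x + y * y == 0) -> y = 0.
  case/andP=> /orP[/eqP-> | /eqP-> //].
  by rewrite mul0r mulr0 !add0r mulf_eq0 orbb => /eqP.
by case=> /iso-> /iso->; rewrite !(mul0r, mulr0, addr0) eqxx.
Qed.

(** A decision tree: [s1] to [s4] isolate 1 and 11 and leave the classes {2, 3, 5, 12, 13}, {4, 7}
    and {6, 8, 9, 10}, which the remaining invariants, valid only inside their class, split
    completely. *)
Lemma J4_isomorphic_eq i j : (1 <= i <= 13)%N -> (1 <= j <= 13)%N ->
  isomorphic (J4 F i) (J4 F j) -> i = j.
Proof.
move=> lei lej iso_ij.
have separate (P : forall V : vectType F, {bilinear V -> V -> V} -> Prop) (C B : pred nat) :
    isomorphism_invariant P ->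
    (forall n, n \in C -> P _ (J4 F n) <-> n \in B) ->
    i \in C -> j \in C -> (i \in B) = (j \in B).
  move=> invP PB iC jC; have := invP _ _ _ _ iso_ij; rewrite PB // PB // => iB.
  by apply/idP/idP => /iB.
have s1 := separate _ _ (pred1 _) (@null_product_invariant F) null_product_J4 lei lej.
have s2 := separate _ _ (mem _) (@null_cube_invariant F) null_cube_J4 lei lej.
have s3 := separate _ _ (predC1 _) (@null_fourth_invariant F) null_fourth_J4 lei lej.
have s4 := separate _ _ (predC (mem _)) (@null_associators_invariant F) null_associators_J4 lei lej.
have s5 := separate _ (mem _) (pred1 _) (@anisotropic_killing_square_invariant F)
  anisotropic_killing_square_J4.
have s6 := separate _ (mem _) (mem _) (@isotropic_central_invariant F) isotropic_central_J4.
have s7 := separate _ (mem _) (mem _) (@orthogonal_anisotropic_invariant F)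
  orthogonal_anisotropic_J4.
have s8 := separate _ (mem _) (pred1 _) (@anisotropic_orthogonal_isotropic_invariant F)
  anisotropic_orthogonal_isotropic_J4.
have s9 := separate _ (mem _) (pred1 _) (@central_square_second_center_invariant F)
  central_square_second_center_J4.
have s10 := separate _ (mem _) (pred1 _) (@isotropic_killing_square_invariant F)
  isotropic_killing_square_J4.
have s11 := separate _ (mem _) (pred1 _) (@isotropic_triple_product_invariant F)
  isotropic_triple_product_J4.
clear separate iso_ij; move: lei lej s1 s2 s3 s4 s5 s6 s7 s8 s9 s10 s11.
case_index i; case_index j;
  move=> _ _ // s1 s2 s3 s4 s5 s6 s7 s8 s9 s10 s11;
  solve [by [] | by move: s1 | by move: s2 | by move: s3 | by move: s4
       | by move: (s5 isT isT) | by move: (s6 isT isT) | by move: (s7 isT isT)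
       | by move: (s8 isT isT) | by move: (s9 isT isT) | by move: (s10 isT isT)
       | by move: (s11 isT isT)].
Qed.

End Separation.

(** * Changes of basis *)

Section Triangular.

Variable F : fieldType.

Section Product.

Variables p1 p2 q1 q2 r1 r2 s t w : F.

(* a^2 = p1 c + p2 d, ab = q1 c + q2 d, b^2 = r1 c + r2 d, ac = s d,
   bc = t d, c^2 = w d, and d annihilates everything. *)
Definition tri_mul (x y : 'rV[F]_4) : 'rV[F]_4 :=
  let x0 := x 0 0 in let x1 := x 0 1 in let x2 := x 0 (inord 2) in
  let y0 := y 0 0 in let y1 := y 0 1 in let y2 := y 0 (inord 2) in
  vec 0 0 (p1 * (x0 * y0) + q1 * (x0 * y1 + x1 * y0) + r1 * (x1 * y1))
    (p2 * (x0 * y0) + q2 * (x0 * y1 + x1 * y0) + r2 * (x1 * y1) +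
     s * (x0 * y2 + x2 * y0) + t * (x1 * y2 + x2 * y1) + w * (x2 * y2)).

Fact tri_mul_is_bilinear : bilinear_for *:%R *:%R tri_mul.
Proof.
by split=> [y k x x' | x k y y'] /=; rewrite /tri_mul vecZ vecD !mxE;
  congr vec; ring.
Qed.

HB.instance Definition _ := bilinear_isBilinear.Build F
  'rV[F]_4 'rV[F]_4 'rV[F]_4 *:%R *:%R tri_mul tri_mul_is_bilinear.

Lemma tri_mul_vec x0 x1 x2 x3 y0 y1 y2 y3 :
  tri_mul (vec x0 x1 x2 x3) (vec y0 y1 y2 y3) =
  vec 0 0 (p1 * (x0 * y0) + q1 * (x0 * y1 + x1 * y0) + r1 * (x1 * y1))
    (p2 * (x0 * y0) + q2 * (x0 * y1 + x1 * y0) + r2 * (x1 * y1) +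
     s * (x0 * y2 + x2 * y0) + t * (x1 * y2 + x2 * y1) + w * (x2 * y2)).
Proof. by rewrite /tri_mul !mxE /= inordK. Qed.

End Product.

Definition mx4 (a0 a1 a2 a3 b0 b1 b2 b3 c0 c1 c2 c3 d0 d1 d2 d3 : F) : 'M[F]_4 :=
  \matrix_(i < 4, j < 4)
    nth 0 (nth [::] [:: [:: a0; a1; a2; a3]; [:: b0; b1; b2; b3];
                        [:: c0; c1; c2; c3]; [:: d0; d1; d2; d3]] i) j.

Lemma mul_vec_mx4 x0 x1 x2 x3 a0 a1 a2 a3 b0 b1 b2 b3 c0 c1 c2 c3 d0 d1 d2 d3 :
  vec x0 x1 x2 x3 *m mx4 a0 a1 a2 a3 b0 b1 b2 b3 c0 c1 c2 c3 d0 d1 d2 d3 =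
  vec (x0 * a0 + x1 * b0 + x2 * c0 + x3 * d0)
      (x0 * a1 + x1 * b1 + x2 * c1 + x3 * d1)
      (x0 * a2 + x1 * b2 + x2 * c2 + x3 * d2)
      (x0 * a3 + x1 * b3 + x2 * c3 + x3 * d3).
Proof.
apply/rowP => j; rewrite !mxE !big_ord_recl big_ord0 !mxE /= addr0 !addrA.
by case: j => [[|[|[|[|//]]]] jlt].
Qed.

(** A one-sided inverse suffices for square matrices; right multiplication by M carries [m1] to
    [m2]. *)
Lemma isomorphic_mx (m1 m2 : {bilinear 'rV[F]_4 -> 'rV[F]_4 -> 'rV[F]_4})
    (M N : 'M[F]_4) :
  (forall x : 'rV[F]_4, x *m N *m M = x) ->
  (forall x y, m2 (x *m M) (y *m M) = m1 x y *m M) -> isomorphic m2 m1.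
Proof.
move=> NM hM; apply: isomorphic_sym.
have NM1 : N *m M = 1%:M.
  by apply/row_matrixP => i; rewrite !rowE mulmxA NM mulmx1.
exists (mulmxr M); split=> [|x y /=]; last by rewrite hM.
exists (mulmxr N) => x /=; last exact: NM.
by rewrite -mulmxA (mulmx1C NM1) mulmx1.
Qed.

End Triangular.

(* The rows of M are the vectors of the new basis in terms of the old one. *)
Local Ltac change_basis M N :=
  apply: (@isomorphic_mx _ _ _ M N);
  elim/vec_ind=> ? ? ? ?; try (elim/vec_ind=> ? ? ? ?);
  rewrite /= ?(J4_vec, tri_mul_vec) /= !mul_vec_mx4 /= ?(J4_vec, tri_mul_vec) /=;
  congr vec.

(** * Normal forms of the triangular products *)

Section Classification.

Variable F : fieldType.
Hypothesis two_neq0 : (2%:R : F) != 0.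
Hypothesis square_root : forall p : F, exists x, p = x * x.

(** Substitute x a + y b and z a + u b for a and b: both binary forms undergo the same substitution,
    and (s, t) transforms as a linear form. *)
Lemma tri_mul_binary (p1 p2 q1 q2 r1 r2 s t w x y z u : F) :
  x * u - y * z != 0 ->
  isomorphic (tri_mul p1 p2 q1 q2 r1 r2 s t w)
    (tri_mul
      (p1 * (x * x) + q1 * (x * y + y * x) + r1 * (y * y))
      (p2 * (x * x) + q2 * (x * y + y * x) + r2 * (y * y))
      (p1 * (x * z) + q1 * (x * u + y * z) + r1 * (y * u))
      (p2 * (x * z) + q2 * (x * u + y * z) + r2 * (y * u))
      (p1 * (z * z) + q1 * (z * u + u * z) + r1 * (u * u))
      (p2 * (z * z) + q2 * (z * u + u * z) + r2 * (u * u))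
      (x * s + y * t) (z * s + u * t) w).
Proof.
move=> D_neq0; pose D := x * u - y * z.
change_basis (mx4 x y 0 0 z u 0 0 0 0 1 0 0 0 0 1)
  (mx4 (u / D) (- y / D) 0 0 (- z / D) (x / D) 0 0 0 0 1 0 0 0 0 1);
  rewrite /D; field => //.
Qed.

(** The three alternatives are rank 0, 1 and 2: with square roots and 2 invertible, a rank 1 form is
    a square and a rank 2 form is a hyperbolic plane. The new basis is (x, y), (z, u). *)
Lemma binary_form (p q r : F) : exists x y z u,
  let p' := p * (x * x) + q * (x * y + y * x) + r * (y * y) in
  let q' := p * (x * z) + q * (x * u + y * z) + r * (y * u) in
  let r' := p * (z * z) + q * (z * u + u * z) + r * (u * u) in
  x * u - y * z != 0 /\
  [\/ [/\ p = 0, q = 0 & r = 0], [/\ p' = 1, q' = 0 & r' = 0] |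
      [/\ p' = 0, q' = 1 & r' = 0]].
Proof.
have [-> | p_neq0] := eqVneq p 0.
  have [-> | q_neq0] := eqVneq q 0.
    have [-> | r_neq0] := eqVneq r 0.
      exists 1, 0, 0, 1 => /=; rewrite mul0r subr0 mulr1 oner_eq0.
      by split=> //; constructor 1.
    have [k rE] := square_root r.
    have k_neq0 : k != 0 by apply: contraNneq r_neq0 => k0; rewrite rE k0 mul0r.
    exists 0, (1 / k), 1, 0 => /=; split.
      by rewrite mul0r mulr1 sub0r oppr_eq0 mul1r invr_eq0.
    by constructor 2; rewrite rE; split; field.
  (* As p = 0, (1, 0) is isotropic; a multiple of it corrects (0, 1) to an isotropic vector. *)
  exists (1 / q), 0, (- r / (2%:R * q)), 1 => /=; split.
    by rewrite mul0r subr0 mulr1 mul1r invr_eq0.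
  by constructor 3; split; field; rewrite ?q_neq0 ?two_neq0.
have [d DE] := square_root (q * q - p * r).
have -> : r = (q * q - d * d) / p by rewrite -DE; field.
have [-> | d_neq0] := eqVneq d 0.
  have [k pE] := square_root p.
  have k_neq0 : k != 0 by apply: contraNneq p_neq0 => k0; rewrite pE k0 mul0r.
  (* For q^2 = p r, the vector (- q / p, 1) spans the radical. *)
  exists (1 / k), 0, (- q / p), 1 => /=; split.
    by rewrite mul0r subr0 mulr1 mul1r invr_eq0.
  by constructor 2; rewrite pE; split; field.
(* The isotropic vectors are ((d - q) / p, 1) and ((- d - q) / p, 1); [k] is their product, by which
   the first is divided. *)
pose k := - (2%:R * d * d) / p.
have dd_neq0 : - (2%:R * d * d) != 0 by rewrite oppr_eq0 !mulf_neq0.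
exists ((d - q) / p / k), (1 / k), ((- q - d) / p), 1 => /=; split.
  have -> : (d - q) / p / k * 1 - 1 / k * ((- q - d) / p) = - d^-1.
    by rewrite /k; field; rewrite ?p_neq0 ?d_neq0 ?dd_neq0.
  by rewrite oppr_eq0 invr_eq0.
by constructor 3; rewrite /k; split; field; rewrite ?p_neq0 ?d_neq0 ?dd_neq0.
Qed.

Lemma tri_mul_J1 : isomorphic (tri_mul 0 0 0 0 0 0 0 0 0) (J4 F 1).
Proof.
change_basis (mx4 1 0 0 0 0 1 0 0 0 0 1 0 0 0 0 1 : 'M[F]_4)
  (mx4 1 0 0 0 0 1 0 0 0 0 1 0 0 0 0 1 : 'M[F]_4); ring.
Qed.

Lemma tri_mul_J2_a p : isomorphic (tri_mul 1 p 0 0 0 0 0 0 0) (J4 F 2).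
Proof.
change_basis (mx4 1 0 0 0 0 0 1 p 0 1 0 0 0 0 0 1)
  (mx4 1 0 0 0 0 0 1 0 0 1 0 (-p) 0 0 0 1); ring.
Qed.

Lemma tri_mul_J2_c : isomorphic (tri_mul 0 0 0 0 0 0 0 0 1) (J4 F 2).
Proof.
change_basis (mx4 0 0 1 0 0 0 0 1 1 0 0 0 0 1 0 0 : 'M[F]_4)
  (mx4 0 0 1 0 0 0 0 1 1 0 0 0 0 1 0 0 : 'M[F]_4); ring.
Qed.

(** The vector c - t a - s b is orthogonal to a and b, and its square is (w - 2st) d for a general
    w. It is central here; for J_{4,5} it is rescaled to have square d. *)
Lemma tri_mul_J3_d s t :
  isomorphic (tri_mul 0 0 0 1 0 0 s t (2%:R * s * t)) (J4 F 3).
Proof.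
change_basis (mx4 1 0 0 0 0 1 0 0 0 0 0 1 (- t) (- s) 1 0)
  (mx4 1 0 0 0 0 1 0 0 t s 0 1 0 0 1 0); ring.
Qed.

Lemma tri_mul_J3_squares : isomorphic (tri_mul 0 1 0 0 0 0 0 0 1) (J4 F 3).
Proof.
have [i i2] := square_root (-1).
have i_neq0 : i != 0.
  by apply: contra_eq_neq i2 => ->; rewrite mulr0 oppr_eq0 oner_eq0.
(* Since [field] does not know i^2 = -1, the coefficient 1 is rewritten as - (i * i). The vectors a
   + c / i and a - c / i are then isotropic with product 2d. *)
suff iso w : w = - (i * i) -> isomorphic (tri_mul 0 1 0 0 0 0 0 0 w) (J4 F 3).
  by apply: iso; rewrite -i2 opprK.
move=> ->.
change_basis (mx4 1 0 (1 / i) 0 1 0 (- 1 / i) 0 0 0 0 2%:R 0 1 0 0)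
  (mx4 (1 / 2%:R) (1 / 2%:R) 0 0 0 0 0 1 (i / 2%:R) (- i / 2%:R) 0 0
       0 0 (1 / 2%:R) 0); field; rewrite ?i_neq0 ?two_neq0 //.
Qed.

Lemma tri_mul_J5 s t w : w != 2%:R * s * t ->
  isomorphic (tri_mul 0 0 0 1 0 0 s t w) (J4 F 5).
Proof.
have [k wE] := square_root (w - 2%:R * s * t).
rewrite -subr_eq0 wE mulf_eq0 orbb => k_neq0.
have -> : w = k * k + 2%:R * s * t by rewrite -wE subrK.
change_basis (mx4 1 0 0 0 0 1 0 0 (- t / k) (- s / k) (1 / k) 0 0 0 0 1)
  (mx4 1 0 0 0 0 1 0 0 t s k 0 0 0 0 1); field => //.
Qed.

Lemma tri_mul_J6 p q r s t : t != 0 ->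
  isomorphic (tri_mul 1 p 0 q 0 r s t 0) (J4 F 6).
Proof.
move=> t_neq0.
(* The new a is a - (s/t) b + k c, which kills c and has square c + e d; the new c is (b + l c) / t.
   [k] makes these two orthogonal and [l] makes the latter isotropic. *)
pose e := p - 2%:R * (s / t) * q + (s / t) * (s / t) * r.
pose k := (s * r / t - q) / t; pose l := - r / (2%:R * t).
change_basis (mx4 1 (- s / t) k 0 0 0 1 e 0 (1 / t) (l / t) 0 0 0 0 1)
  (mx4 1 (- s * l / t - k) s (s * l * e / t + k * e) 0 (- l) t (l * e)
       0 1 0 (- e) 0 0 0 1);
  rewrite /e /k /l; field; rewrite ?t_neq0 ?two_neq0 //.
Qed.

(** The vector b - (q/s) c is orthogonal to a; its square is zero here and r d in the setting of
    J_{4,7}, where it is rescaled to s d = a a^2. *)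
Lemma tri_mul_J4 p q s : s != 0 ->
  isomorphic (tri_mul 1 p 0 q 0 0 s 0 0) (J4 F 4).
Proof.
move=> s_neq0.
change_basis (mx4 1 0 0 0 0 0 1 p 0 0 0 s 0 1 (- q / s) 0)
  (mx4 1 0 0 0 0 (q / s) (- p * q / (s * s)) 1 0 1 (- p / s) 0 0 0 (1 / s) 0);
  field => //.
Qed.

Lemma tri_mul_J7 p q r s : s != 0 -> r != 0 ->
  isomorphic (tri_mul 1 p 0 q 0 r s 0 0) (J4 F 7).
Proof.
have [k rE] := square_root (r / s) => s_neq0 r_neq0.
have k_neq0 : k != 0.
  by apply: contraNneq r_neq0 => k0; rewrite -(divfK s_neq0 r) rE k0 !mul0r.
have -> : r = s * (k * k) by rewrite -rE mulrC divfK.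
change_basis (mx4 1 0 0 0 0 0 1 p 0 (1 / k) (- q / (s * k)) 0 0 0 0 s)
  (mx4 1 0 0 0 0 (q / s) k (- p * q / (s * s)) 0 1 0 (- p / s) 0 0 0 (1 / s));
  field; rewrite ?k_neq0 ?s_neq0 //.
Qed.

(** Complete the square: a - (q/r) b is orthogonal to b. The suffixes [rank1] and [rank2] refer to
    the binary form of c-coordinates. *)
Lemma tri_mul_J13_rank1 p q r : r != 0 ->
  isomorphic (tri_mul 1 p 0 q 0 r 0 0 0) (J4 F 13).
Proof.
move=> r_neq0; pose e := p - q * q / r.
change_basis (mx4 1 (- q / r) 0 0 0 1 0 0 0 0 1 e 0 0 0 r)
  (mx4 1 (q / r) 0 0 0 1 0 0 0 0 1 (- e / r) 0 0 0 (1 / r));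
  rewrite /e; field => //.
Qed.

Lemma tri_mul_J12_rank1 p q : q != 0 ->
  isomorphic (tri_mul 1 p 0 q 0 0 0 0 0) (J4 F 12).
Proof.
move=> q_neq0.
change_basis (mx4 1 0 0 0 0 1 0 0 0 0 1 p 0 0 0 q)
  (mx4 1 0 0 0 0 1 0 0 0 0 1 (- p / q) 0 0 0 (1 / q)); field => //.
Qed.

Lemma tri_mul_J10 p q r s t : s != 0 -> t != 0 ->
  isomorphic (tri_mul 0 p 1 q 0 r s t 0) (J4 F 10).
Proof.
move=> s_neq0 t_neq0.
(* [k] and [l] make a - k c and b - l c isotropic, with product c + e d; scaling them by t and s
   gives both the same product with the new c. *)
pose k := p / (2%:R * s); pose l := r / (2%:R * t).
pose e := q - s * l - t * k; pose z := s * t.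
change_basis
  (mx4 t 0 (- t * k) 0 0 s (- s * l) 0 0 0 z (z * e) 0 0 0 (z * z))
  (mx4 (1 / t) 0 (k / z) (- k * e / (z * z)) 0 (1 / s) (l / z) (- l * e / (z * z))
       0 0 (1 / z) (- e / (z * z)) 0 0 0 (1 / (z * z)));
  rewrite /z /e /k /l; field; rewrite ?s_neq0 ?t_neq0 ?two_neq0 //.
Qed.

Lemma tri_mul_J8 p q s : s != 0 ->
  isomorphic (tri_mul 0 p 1 q 0 0 s 0 0) (J4 F 8).
Proof.
move=> s_neq0; pose k := p / (2%:R * s).
change_basis (mx4 1 0 (- k) 0 0 1 0 0 0 0 1 q 0 0 0 s)
  (mx4 1 0 k (- k * q / s) 0 1 0 0 0 0 1 (- q / s) 0 0 0 (1 / s));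
  rewrite /k; field; rewrite ?s_neq0 ?two_neq0 //.
Qed.

Lemma tri_mul_J9 p q r s : s != 0 -> r != 0 ->
  isomorphic (tri_mul 0 p 1 q 0 r s 0 0) (J4 F 9).
Proof.
move=> s_neq0 r_neq0; pose k := p / (2%:R * s).
change_basis
  (mx4 1 0 (- k) 0 0 (s / r) 0 0 0 0 (s / r) (q * s / r) 0 0 0 (s * s / r))
  (mx4 1 0 (k * r / s) (- k * q * r / (s * s)) 0 (r / s) 0 0
       0 0 (r / s) (- q * r / (s * s)) 0 0 0 (r / (s * s)));
  rewrite /k; field; rewrite ?s_neq0 ?r_neq0 ?two_neq0 //.
Qed.

Lemma tri_mul_J3_c q : isomorphic (tri_mul 0 0 1 q 0 0 0 0 0) (J4 F 3).
Proof.
change_basis (mx4 1 0 0 0 0 1 0 0 0 0 1 q 0 0 0 1)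
  (mx4 1 0 0 0 0 1 0 0 0 0 1 (- q) 0 0 0 1); ring.
Qed.

Lemma tri_mul_J12_rank2 p q : p != 0 ->
  isomorphic (tri_mul 0 p 1 q 0 0 0 0 0) (J4 F 12).
Proof.
move=> p_neq0.
change_basis (mx4 1 0 0 0 0 1 0 0 0 0 0 p 0 0 1 q)
  (mx4 1 0 0 0 0 1 0 0 0 0 (- q / p) 1 0 0 (1 / p) 0); field => //.
Qed.

Lemma tri_mul_J13_rank2 p q r : p != 0 -> r != 0 ->
  isomorphic (tri_mul 0 p 1 q 0 r 0 0 0) (J4 F 13).
Proof.
have [y ->] := square_root p; have [x ->] := square_root r.
rewrite !mulf_eq0 !orbb => y_neq0 x_neq0.
have four_neq0 : (4%:R : F) != 0 by rewrite (natrM _ 2 2) mulf_neq0.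
(* With a^2 = y^2 d and b^2 = x^2 d, the vectors x a + y b and x a - y b are orthogonal, and their
   squares span <c, d>. *)
pose z := x * y.
change_basis
  (mx4 x y 0 0 x (- y) 0 0 0 0 (2%:R * z) (2%:R * z * z + 2%:R * z * q)
       0 0 (- 2%:R * z) (2%:R * z * z - 2%:R * z * q))
  (mx4 (1 / (2%:R * x)) (1 / (2%:R * x)) 0 0 (1 / (2%:R * y)) (- 1 / (2%:R * y)) 0 0
       0 0 (1 / (4%:R * z) - q / (4%:R * z * z)) (- 1 / (4%:R * z) - q / (4%:R * z * z))
       0 0 (1 / (4%:R * z * z)) (1 / (4%:R * z * z)));
  rewrite /z; field; rewrite ?y_neq0 ?x_neq0 ?two_neq0 ?four_neq0 //.
Qed.

(** Here a^2 = d, so a splits off as an orthogonal summand, with complement spanned by b, c - s a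
    and d. *)
Lemma tri_mul_rotate_center (s t w : F) :
  isomorphic (tri_mul 0 1 0 0 0 0 s t w) (tri_mul 0 0 0 t 0 (w - s * s) 0 0 1).
Proof.
change_basis (mx4 0 1 0 0 (- s) 0 1 0 1 0 0 0 0 0 0 1)
  (mx4 0 0 1 0 1 0 0 0 0 1 s 0 0 0 0 1); ring.
Qed.

Lemma tri_mul_permute (p q r s t w : F) :
  isomorphic (tri_mul 0 p 0 q 0 r s t w) (tri_mul 0 p 0 s 0 w q t r).
Proof.
change_basis (mx4 1 0 0 0 0 0 1 0 0 1 0 0 0 0 0 1 : 'M[F]_4)
  (mx4 1 0 0 0 0 0 1 0 0 1 0 0 0 0 0 1 : 'M[F]_4); ring.
Qed.

Lemma tri_mul_swap (p1 p2 q1 q2 r1 r2 s t w : F) :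
  isomorphic (tri_mul p1 p2 q1 q2 r1 r2 s t w)
    (tri_mul r1 r2 q1 q2 p1 p2 t s w).
Proof.
change_basis (mx4 0 1 0 0 1 0 0 0 0 0 1 0 0 0 0 1 : 'M[F]_4)
  (mx4 0 1 0 0 1 0 0 0 0 0 1 0 0 0 0 1 : 'M[F]_4); ring.
Qed.

Definition listed (V : vectType F) (m : {bilinear V -> V -> V}) : Prop :=
  exists2 n : nat, (1 <= n <= 13)%N & isomorphic m (J4 F n).

Lemma listed_isomorphic (V W : vectType F) (mV : {bilinear V -> V -> V})
    (mW : {bilinear W -> W -> W}) :
  isomorphic mV mW -> listed mW -> listed mV.
Proof. by move=> isoVW [n len isoWn]; exists n => //; apply: isomorphic_trans isoWn. Qed.

Lemma tri_mul_normal_center (p q r s t w : F) :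
  [/\ p = 0, q = 0 & r = 0] \/ exists x y z u,
    let s' := x * s + y * t in let t' := z * s + u * t in
    isomorphic (tri_mul 0 p 0 q 0 r s t w) (tri_mul 0 1 0 0 0 0 s' t' w) \/
    isomorphic (tri_mul 0 p 0 q 0 r s t w) (tri_mul 0 0 0 1 0 0 s' t' w).
Proof.
have [x [y [z [u [D_neq0]]]]] := binary_form p q r.
have := tri_mul_binary 0 p 0 q 0 r s t w D_neq0.
rewrite !mul0r !addr0 => iso [zero | [p' q' r'] | [p' q' r']]; first by left.
  by right; exists x, y, z, u; left; rewrite p' q' r' in iso.
by right; exists x, y, z, u; right; rewrite p' q' r' in iso.
Qed.

Lemma tri_mul_normal (p1 p2 q1 q2 r1 r2 s t : F) :
  [/\ p1 = 0, q1 = 0 & r1 = 0] \/ exists p q r s' t',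
    isomorphic (tri_mul p1 p2 q1 q2 r1 r2 s t 0) (tri_mul 1 p 0 q 0 r s' t' 0) \/
    isomorphic (tri_mul p1 p2 q1 q2 r1 r2 s t 0) (tri_mul 0 p 1 q 0 r s' t' 0).
Proof.
have [x [y [z [u [D_neq0]]]]] := binary_form p1 q1 r1.
have := tri_mul_binary p1 p2 q1 q2 r1 r2 s t 0 D_neq0.
move=> iso [zero | [p' q' r'] | [p' q' r']]; first by left.
  by right; do 5!eexists; left; rewrite p' q' r' in iso; apply: iso.
by right; do 5!eexists; right; rewrite p' q' r' in iso; apply: iso.
Qed.

Lemma listed_hyperbolic_center (s t w : F) : listed (tri_mul 0 0 0 1 0 0 s t w).
Proof.
have [-> | w_neq] := eqVneq w (2%:R * s * t).
  by exists 3%N => //; apply: tri_mul_J3_d.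
by exists 5%N => //; apply: tri_mul_J5.
Qed.

(** Once a is split off, the binary form left on b and c - s a has rank 0, 1 or 2; each is a known
    case. *)
Lemma listed_square_center (s t w : F) : listed (tri_mul 0 1 0 0 0 0 s t w).
Proof.
apply: listed_isomorphic (tri_mul_rotate_center s t w) _.
have [[_ -> ->] | ] := tri_mul_normal_center 0 t (w - s * s) 0 0 1.
  by exists 2%N => //; apply: tri_mul_J2_c.
case=> x [y [z [u /=]]]; rewrite !mulr0 !addr0 => -[iso | iso].
  by exists 3%N => //; apply: isomorphic_trans iso tri_mul_J3_squares.
exact: listed_isomorphic iso (listed_hyperbolic_center _ _ _).
Qed.

Lemma listed_form_center (p q r s t w : F) : ~ [/\ p = 0, q = 0 & r = 0] ->
  listed (tri_mul 0 p 0 q 0 r s t w).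
Proof.
move=> nz; have [// | [x [y [z [u /= [iso | iso]]]]]] :=
  tri_mul_normal_center p q r s t w; apply: listed_isomorphic iso _.
  exact: listed_square_center.
exact: listed_hyperbolic_center.
Qed.

(** The product is a ternary quadratic form with values in <d>; its ranks 0, 1, 2, 3 give J_{4,1},
    J_{4,2}, J_{4,3}, J_{4,5}. *)
Lemma listed_center (p q r s t w : F) : listed (tri_mul 0 p 0 q 0 r s t w).
Proof.
case: (boolP [&& p == 0, q == 0 & r == 0]) => [/and3P[/eqP-> /eqP-> /eqP->] | nz];
  last by apply: listed_form_center => -[p0 q0 r0]; rewrite p0 q0 r0 eqxx in nz.
(* If the form vanishes on a and b, exchanging b and c exposes the coefficients s and w; a further
   swap exposes t. *)
apply: listed_isomorphic (tri_mul_permute _ _ _ _ _ _) _.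
case: (boolP ((s == 0) && (w == 0))) => [/andP[/eqP-> /eqP->] | nz];
  last by apply: listed_form_center => -[_ s0 w0]; rewrite s0 w0 eqxx in nz.
apply: listed_isomorphic (tri_mul_swap _ _ _ _ _ _ _ _ _) _.
apply: listed_isomorphic (tri_mul_permute _ _ _ _ _ _) _.
have [-> | t_neq0] := eqVneq t 0; first by exists 1%N => //; apply: tri_mul_J1.
by apply: listed_form_center => -[_ t0 _]; rewrite t0 eqxx in t_neq0.
Qed.

Lemma listed_tri_mul (p1 p2 q1 q2 r1 r2 s t w : F) :
  w = 0 \/ [/\ p1 = 0, q1 = 0 & r1 = 0] ->
  listed (tri_mul p1 p2 q1 q2 r1 r2 s t w).
Proof.
case=> [-> | [-> -> ->]]; last exact: listed_center.
have [[-> -> ->] | ] := tri_mul_normal p1 p2 q1 q2 r1 r2 s t.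
  exact: listed_center.
case=> p [q [r [s' [t' [] iso]]]];
  apply: listed_isomorphic iso _ => {s t}; move: s' t' => s t.
  have [-> | t_neq0] := eqVneq t 0; last by exists 6%N => //; apply: tri_mul_J6.
  have [-> | s_neq0] := eqVneq s 0; have [-> | r_neq0] := eqVneq r 0.
  - have [-> | q_neq0] := eqVneq q 0; first by exists 2%N => //; apply: tri_mul_J2_a.
    by exists 12%N => //; apply: tri_mul_J12_rank1.
  - by exists 13%N => //; apply: tri_mul_J13_rank1.
  - by exists 4%N => //; apply: tri_mul_J4.
  - by exists 7%N => //; apply: tri_mul_J7.
(* In rank 2, swapping a and b exchanges s and t, so if one of them vanishes it may be taken to be
   t. *)
have listed_t0 p' r' s' : listed (tri_mul 0 p' 1 q 0 r' s' 0 0).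
  have [-> | s_neq0] := eqVneq s' 0; have [-> | r_neq0] := eqVneq r' 0.
  - have [-> | p_neq0] := eqVneq p' 0; first by exists 3%N => //; apply: tri_mul_J3_c.
    by exists 12%N => //; apply: tri_mul_J12_rank2.
  - have [-> | p_neq0] := eqVneq p' 0; last by exists 13%N => //; apply: tri_mul_J13_rank2.
    apply: listed_isomorphic (tri_mul_swap _ _ _ _ _ _ _ _ _) _.
    by exists 12%N => //; apply: tri_mul_J12_rank2.
  - by exists 8%N => //; apply: tri_mul_J8.
  - by exists 9%N => //; apply: tri_mul_J9.
have [-> // | t_neq0] := eqVneq t 0.
have [-> | s_neq0] := eqVneq s 0; last by exists 10%N => //; apply: tri_mul_J10.
exact: listed_isomorphic (tri_mul_swap _ _ _ _ _ _ _ _ _) (listed_t0 _ _ _).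
Qed.

End Classification.

(** * Bases adapted to the lower central series *)

Section Basis.

Variables (F : fieldType) (V : vectType F) (m : {bilinear V -> V -> V}).

Lemma isomorphic_basis (m' : {bilinear 'rV[F]_4 -> 'rV[F]_4 -> 'rV[F]_4})
    (X : 4.-tuple V) : basis_of fullv X ->
  (forall x y, m x y = m y x) -> (forall x y, m' x y = m' y x) ->
  (forall p q : 'I_4, (p <= q)%N ->
    m X`_p X`_q = \sum_i m' (delta_mx 0 p) (delta_mx 0 q) 0 i *: X`_i) ->
  isomorphic m m'.
Proof.
move=> basisX mC m'C Xmul.
pose g (x : 'rV[F]_4) := \sum_i x 0 i *: X`_i.
have g_linear : linear g.
  move=> k x y; rewrite /g scaler_sumr -big_split; apply: eq_bigr => i _.
  by rewrite !mxE scalerDl scalerA.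
pose gL := GRing.isLinear.Build F _ _ _ g g_linear.
pose G : {linear 'rV[F]_4 -> V} := HB.pack g gL.
apply: isomorphic_sym; exists G; split=> [|x y].
  exists (fun v => \row_i coord X i v) => [x | v].
    apply/rowP => i; rewrite mxE coord_sum_free //; exact: basis_free basisX.
  rewrite [RHS](coord_basis basisX (memvf v)); apply: eq_bigr => i _.
  by rewrite mxE.
have GX i : G (delta_mx 0 i) = X`_i.
  rewrite /= /g (bigD1 i) //= mxE !eqxx scale1r big1 ?addr0 // => j /negPf nij.
  by rewrite mxE nij andbF scale0r.
have Gmul p q : G (m' (delta_mx 0 p) (delta_mx 0 q)) = m X`_p X`_q.
  case/orP: (leq_total p q) => le_pq; first by rewrite Xmul.
  by rewrite m'C mC Xmul.
rewrite [x in LHS]row_sum_delta [y in LHS]row_sum_delta.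
rewrite linear_sumlz linear_sum [RHS]linear_sumlz; apply: eq_bigr => p _.
rewrite linear_sumr linear_sum [RHS]linear_sumr; apply: eq_bigr => q _.
rewrite !(linearZl_LR, linearZr_LR, linearZ) /= -Gmul.
by rewrite !scalerA mulrC.
Qed.

Lemma delta_mx_vec (p : 'I_4) :
  delta_mx 0 p = vec (p == 0%N :> nat)%:R (p == 1%N :> nat)%:R
                     (p == 2%N :> nat)%:R (p == 3%N :> nat)%:R :> 'rV[F]_4.
Proof.
apply/rowP => i; rewrite !mxE -val_eqE /=.
case: i => [[|[|[|[|//]]]] ilt]; case: p => [[|[|[|[|//]]]] plt] //=.
Qed.

Lemma basis4 (a b c d : V) : \dim {:V} = 4%N ->
  (fullv <= <[a]> + (<[b]> + (<[c]> + <[d]>)))%VS ->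
  basis_of fullv [tuple a; b; c; d].
Proof.
move=> dimV spanV; rewrite basisEdim dimV andbT.
by rewrite !span_cons span_nil addv0.
Qed.

(** Concatenate bases of a complement of W, of a complement of U in W, and of U: the last vectors
    span U and W. Only inclusions are claimed, as the dimensions may be smaller than 1 and 2. *)
Lemma basis_of_flag (U W : {vspace V}) :
    \dim {:V} = 4%N -> (U <= W)%VS -> (\dim U <= 1)%N -> (\dim W <= 2)%N ->
  exists a b c d, [/\ basis_of fullv [tuple a; b; c; d],
    (U <= <[d]>)%VS & (W <= <[c]> + <[d]>)%VS].
Proof.
move=> dimV sUW dimU dimW.
pose X := vbasis (W^C) ++ (vbasis (W :\: U) ++ vbasis U).
have dimWU : (\dim (W :\: U) + \dim U = \dim W)%N.
  by rewrite addnC -(dimv_cap_compl W U) (capv_idPr sUW).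
have dimWC : \dim (W^C) = (4 - \dim W)%N by rewrite dimv_compl dimV.
have spanWU : (<<vbasis (W :\: U) ++ vbasis U>> = W)%VS.
  by rewrite span_cat !(span_basis (vbasisP _)) addv_diff (addv_idPl sUW).
have sizeX : size X = 4%N.
  rewrite !size_cat !size_tuple dimWU dimWC subnK //.
  exact: leq_trans dimW _.
have spanX : (<<X>> = fullv)%VS.
  by rewrite span_cat spanWU (span_basis (vbasisP _)) addvC addv_complf.
have dropU : drop (4 - \dim U) X = vbasis U.
  rewrite /X catA drop_size_cat // size_cat !size_tuple dimWC.
  by move: dimWU dimW; lia.
have dropW : drop (4 - \dim W) X = vbasis (W :\: U) ++ vbasis U.
  by rewrite /X drop_size_cat // size_tuple dimWC.
have sub_drop k n : (k <= n)%N -> (<<drop n X>> <= <<drop k X>>)%VS.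
  by move=> le_kn; apply: sub_span => x; rewrite -(subnK le_kn) -drop_drop => /mem_drop.
have sUX : (U <= <<drop 3 X>>)%VS.
  by rewrite -[X in (X <= _)%VS](span_basis (vbasisP U)) -dropU sub_drop //; lia.
have sWX : (W <= <<drop 2 X>>)%VS.
  by rewrite -[X in (X <= _)%VS]spanWU -dropW sub_drop //; lia.
move: sizeX spanX sUX sWX; case: X {dropU dropW sub_drop} => [|a [|b [|c [|d []]]]] //= _.
rewrite !span_cons span_nil !addv0 => spanX sUd sWcd; exists a, b, c, d; split=> //.
by apply: basis4; rewrite ?spanX.
Qed.

End Basis.

Section LowerCentralSeries.

Variables (F : fieldType) (V : vectType F) (m : {bilinear V -> V -> V}).

Lemma mem_jpowerS n u w : u \in jpower m n.+1 -> m u w \in jpower m n.+2.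
Proof. by move=> uJ; apply: mem_prodsp (memvf w). Qed.

Lemma jpowerS_sub n : (jpower m n.+2 <= jpower m n.+1)%VS.
Proof.
elim: n => [|n IHn]; first exact: subvf.
by apply/prodspP => u w uJ _; apply: mem_jpowerS; apply: subvP IHn _ uJ.
Qed.

(** If two consecutive powers agree, the series is constant from there on, hence zero; otherwise the
    dimension drops. The truncated predecessor covers the zero power. *)
Lemma jpower_dimS n : is_nilpotent m ->
  (\dim (jpower m n.+2) <= (\dim (jpower m n.+1)).-1)%N.
Proof.
case=> N J0.
have [stable | neqJ] := eqVneq (jpower m n.+2) (jpower m n.+1).
  have stableD k : jpower m (k + n).+1 = jpower m n.+1.
    elim: k => // k IHk; rewrite -[in RHS]stable.
    by rewrite -[LHS]/(prodsp m (jpower m (k + n).+1) fullv) IHk.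
  have subJ k : (jpower m (k + N).+1 <= jpower m N)%VS.
    elim: k => [|k IHk]; last exact: subv_trans (jpowerS_sub _) IHk.
    (* N = 0 is harmless, as J^<0> = J. *)
    by case: (N) => [|N']; [apply: subvf | apply: jpowerS_sub].
  suff J0n : jpower m n.+1 = 0%VS by rewrite stable J0n dimv0.
  by apply/eqP; rewrite -subv0 -J0 -(stableD N) addnC subJ.
have [ledim /esym] := dimv_leqif_eq (jpowerS_sub n); rewrite (negPf neqJ).
by move: ledim; lia.
Qed.

End LowerCentralSeries.

(** * Nilpotent Jordan algebras of dimension four, by the dimension of J^<2> *)

Section NilpotentJordan.

Variables (F : fieldType) (V : vectType F) (m : {bilinear V -> V -> V}).
Hypothesis dimV : \dim {:V} = 4%N.
Hypothesis jordan_m : is_jordan m.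
Hypothesis nilpotent_m : is_nilpotent m.

Let mC : forall x y, m x y = m y x := proj1 jordan_m.
Let mJ : forall x y, m (m x x) (m x y) = m x (m (m x x) y) := proj2 jordan_m.

Lemma jpower4_eq0 : (\dim (jpower m 2) <= 2)%N -> jpower m 4 = 0%VS.
Proof.
have := jpower_dimS 1 nilpotent_m; have := jpower_dimS 2 nilpotent_m.
by move=> d4 d3 d2; apply/eqP; rewrite -dimv_eq0; lia.
Qed.

Lemma isomorphic_tri_mul (a b c d : V) p1 p2 q1 q2 r1 r2 s t w :
  basis_of fullv [tuple a; b; c; d] ->
  m a a = p1 *: c + p2 *: d -> m a b = q1 *: c + q2 *: d ->
  m b b = r1 *: c + r2 *: d -> m a c = s *: d -> m b c = t *: d ->
  m c c = w *: d -> (forall x, m x d = 0) ->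
  isomorphic m (tri_mul p1 p2 q1 q2 r1 r2 s t w).
Proof.
move=> basisX aa ab bb ac bc cc xd.
apply: isomorphic_basis basisX mC _ _ => [x y | p q].
  by rewrite /tri_mul; congr vec; ring.
rewrite !delta_mx_vec /= tri_mul_vec !big_ord_recl big_ord0 !mxE /=.
case: p q => [[|[|[|[|//]]]] plt] [[|[|[|[|//]]]] qlt] //= _;
  rewrite ?aa ?ab ?bb ?ac ?bc ?cc ?xd
    ?(mulr0, mul0r, mulr1, addr0, add0r, scale0r) //.
Qed.

Lemma isomorphic_J11 (a b c d : V) :
  basis_of fullv [tuple a; b; c; d] ->
  m a a = b -> m a b = c -> m b b = d -> m a c = d -> m b c = 0 -> m c c = 0 ->
  (forall x, m x d = 0) -> isomorphic m (J4 F 11).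
Proof.
move=> basisX aa ab bb ac bc cc xd.
apply: isomorphic_basis basisX mC _ _ => [x y | p q].
  by have [comm _] := @J4_jordan F 11 isT; apply: comm.
rewrite !delta_mx_vec /= J4_vec /= !big_ord_recl big_ord0 !mxE /=.
case: p q => [[|[|[|[|//]]]] plt] [[|[|[|[|//]]]] qlt] //= _;
  rewrite ?aa ?ab ?bb ?ac ?bc ?cc ?xd
    ?(mulr0, mul0r, mulr1, addr0, add0r, scale0r, scale1r) //.
Qed.

Lemma isomorphic_tri_mul_dim_le1 : (\dim (jpower m 2) <= 1)%N ->
  exists p q r s t w, isomorphic m (tri_mul 0 p 0 q 0 r s t w).
Proof.
move=> dimJ2.
have [a [b [c [d [basisX sJd _]]]]] :=
  basis_of_flag dimV (subvv (jpower m 2)) dimJ2 (leqW dimJ2).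
have prod x y : exists k, m x y = k *: d.
  by apply/vlineP/(subvP sJd)/mem_jpowerS/memvf.
have J3 : jpower m 3 = 0%VS.
  have := jpower_dimS 1 nilpotent_m.
  by move=> d3; apply/eqP; rewrite -dimv_eq0; lia.
(* Either all products vanish or d spans J^<2>, and J^<3> = 0. *)
have xd x : m x d = 0.
  have [J20 | J2_neq0] := eqVneq (jpower m 2) 0%VS.
    by apply/eqP; rewrite -memv0 -J20; apply/mem_jpowerS/memvf.
  have dJ2 : d \in jpower m 2.
    have -> : jpower m 2 = <[d]>%VS; last exact: memv_line.
    apply/eqP; rewrite eqEdim sJd dim_vline.
    by rewrite (leq_trans (leq_b1 _)) // lt0n dimv_eq0.
  by rewrite mC; apply/eqP; rewrite -memv0 -J3; apply: mem_jpowerS.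
have [p aa] := prod a a; have [q ab] := prod a b; have [r bb] := prod b b.
have [s ac] := prod a c; have [t bc] := prod b c; have [w cc] := prod c c.
exists p, q, r, s, t, w.
by apply: isomorphic_tri_mul basisX _ _ _ _ _ _ _; rewrite ?scale0r ?add0r.
Qed.

Hypothesis two_neq0 : (2%:R : F) != 0.

Lemma isomorphic_tri_mul_dim2 : \dim (jpower m 2) = 2%N ->
  exists p1 p2 q1 q2 r1 r2 s t w,
    (w = 0 \/ [/\ p1 = 0, q1 = 0 & r1 = 0]) /\
    isomorphic m (tri_mul p1 p2 q1 q2 r1 r2 s t w).
Proof.
move=> dimJ2.
have J4_0 : jpower m 4 = 0%VS by apply: jpower4_eq0; rewrite dimJ2.
have dimJ3 : (\dim (jpower m 3) <= 1)%N.
  by have := jpower_dimS 1 nilpotent_m; rewrite dimJ2.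
have [|a [b [c [d [basisX sJ3d sJ2cd]]]]] :=
  basis_of_flag dimV (jpowerS_sub m 1) dimJ3; first by rewrite dimJ2.
have J2_cd : jpower m 2 = (<[c]> + <[d]>)%VS.
  apply/eqP; rewrite eqEdim sJ2cd dimJ2.
  apply: leq_trans (dimv_add_leqif _ _) _.
  by rewrite !dim_vline; do 2!case: (_ != 0).
have cJ2 : c \in jpower m 2 by rewrite J2_cd (subvP (addvSl _ _)) ?memv_line.
have dJ2 : d \in jpower m 2 by rewrite J2_cd (subvP (addvSr _ _)) ?memv_line.
have xJ3 x u : u \in jpower m 3 -> m x u = 0.
  by move=> uJ3; apply/eqP; rewrite mC -memv0 -J4_0 mem_jpowerS.
have xd x : m x d = 0.
  have [J30 | J3_neq0] := eqVneq (jpower m 3) 0%VS.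
    by apply/eqP; rewrite -memv0 -J30 mC mem_jpowerS.
  apply: xJ3; have -> : jpower m 3 = <[d]>%VS; last exact: memv_line.
  apply/eqP; rewrite eqEdim sJ3d dim_vline.
  by rewrite (leq_trans (leq_b1 _)) // lt0n dimv_eq0.
have prod x y : exists k l, m x y = k *: c + l *: d.
  have : m x y \in jpower m 2 by apply/mem_jpowerS/memvf.
  by rewrite J2_cd => /memv_addP[_ /vlineP[k ->] [_ /vlineP[l ->] ->]]; exists k, l.
have prodc x : exists k, m x c = k *: d.
  by rewrite mC; apply/vlineP/(subvP sJ3d)/mem_jpowerS.
have [p1 [p2 aa]] := prod a a; have [q1 [q2 ab]] := prod a b.
have [r1 [r2 bb]] := prod b b; have [s ac] := prodc a; have [t bc] := prodc b.
have [w cc] := prodc c.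
exists p1, p2, q1, q2, r1, r2, s, t, w; split; last exact: isomorphic_tri_mul basisX aa ab bb ac bc cc xd.
have [-> | w_neq0] := eqVneq w 0; [by left | right].
(* By the Jordan identity x^2 x^2 = x (x^2 x) lies in J^<4> = 0, while x^2 x^2 = k^2 w d. *)
have square_c x k l : m x x = k *: c + l *: d -> k = 0.
  move=> xx; have : m (m x x) (m x x) = 0.
    by rewrite mJ xJ3 // mem_jpowerS // mem_jpowerS // memvf.
  rewrite xx linearDr [m _ (l *: d)]linearZr_LR xd scaler0 addr0.
  rewrite linearZr_LR mC linearDr [m _ (l *: d)]linearZr_LR xd scaler0 addr0.
  rewrite linearZr_LR cc !scalerA => /eqP; rewrite scaler_eq0 !mulf_eq0 orbb.
  rewrite (negPf w_neq0) orbF => /orP[/eqP // | /eqP d0].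
  have dX : d \in [tuple a; b; c; d] by rewrite !inE eqxx !orbT.
  by have := free_not0 (basis_free basisX) dX; rewrite d0 eqxx.
have p10 := square_c _ _ _ aa; have r10 := square_c _ _ _ bb.
(* Polarization: the square of a + b yields 2 q1 = 0. *)
split=> //; have /square_c : m (a + b) (a + b) =
    (2%:R * q1) *: c + (p2 + 2%:R * q2 + r2) *: d.
  rewrite linearDl !linearDr (mC b a) aa ab bb p10 r10 !scale0r !add0r.
  rewrite !scalerDl !mulr_natl !mulr2n !scalerDl.
  by rewrite [LHS](AC (1*2*(2*1)) ((2*4)*(1*(3*5)*6))).
by move/eqP; rewrite mulf_eq0 (negPf two_neq0) => /eqP.
Qed.

Lemma isomorphic_J11_dim3 : \dim (jpower m 2) = 3%N -> isomorphic m (J4 F 11).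
Proof.
move=> dimJ2.
have J5_0 : jpower m 5 = 0%VS.
  have := jpower_dimS 1 nilpotent_m; have := jpower_dimS 2 nilpotent_m.
  have := jpower_dimS 3 nilpotent_m; rewrite dimJ2.
  by move=> d5 d4 d3; apply/eqP; rewrite -dimv_eq0; lia.
have J4x u x : u \in jpower m 4 -> m u x = 0.
  by move=> uJ; apply/eqP; rewrite -memv0 -J5_0 mem_jpowerS.
have xJ4 u x : u \in jpower m 4 -> m x u = 0 by move=> uJ; rewrite mC J4x.
have J2mem x y : m x y \in jpower m 2 by apply/mem_jpowerS/memvf.
have [a span_a] : exists a, fullv = (<[a]> + jpower m 2)%VS.
  have : \dim ((jpower m 2)^C) = 1%N by rewrite dimv_compl dimV dimJ2.
  have := span_basis (vbasisP ((jpower m 2)^C)).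
  move: (vbasis _) => X spanX dim1; move: X spanX; rewrite dim1 => X spanX.
  exists X`_0; rewrite -(addv_complf (jpower m 2)) addvC -spanX.
  by case/tupleP: X {spanX} => x X; rewrite (tuple0 X) span_seq1.
pose b := m a a; pose c := m b a; pose d := m c a.
have bJ2 : b \in jpower m 2 by apply: J2mem.
have cJ3 : c \in jpower m 3 by apply: mem_jpowerS.
have dJ4 : d \in jpower m 4 by apply: mem_jpowerS.
(* The Jordan identity with x = y = a. *)
have bb : m b b = d by rewrite mJ mC.
have bbJ4 : m b b \in jpower m 4 by rewrite bb.
have decomp x : exists k u, u \in jpower m 2 /\ x = k *: a + u.
  have : x \in fullv by apply: memvf.
  by rewrite span_a => /memv_addP[_ /vlineP[k ->] [u uJ ->]]; exists k, u.
have sJ2 : (jpower m 2 <= <[b]> + jpower m 3)%VS.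
  apply/prodspP => u w _ _.
  have [k [u2 [u2J ->]]] := decomp u; have [l [w2 [w2J ->]]] := decomp w.
  rewrite linearDl linearDr -addrA; apply: memv_add.
    by rewrite linearZl_LR linearZr_LR !memvZ // memv_line.
  by rewrite rpredD ?[m (k *: a) w2]mC ?mem_jpowerS.
have decomp2 x : x \in jpower m 2 -> exists k u, u \in jpower m 3 /\ x = k *: b + u.
  move=> /(subvP sJ2).
  by case/memv_addP=> [_ /vlineP[k ->] [u uJ ->]]; exists k, u.
have bJ2J4 u : u \in jpower m 2 -> m b u \in jpower m 4.
  move=> /decomp2[k [u3 [u3J ->]]]; rewrite linearDr rpredD //.
    by rewrite linearZr_LR memvZ.
  by rewrite mC mem_jpowerS.
have sJ3 : (jpower m 3 <= <[c]> + jpower m 4)%VS.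
  apply/prodspP => u w uJ _; have [k [u3 [u3J ->]]] := decomp2 u uJ.
  have [l [w2 [w2J ->]]] := decomp w.
  rewrite linearDl [m (k *: b) _]linearDr -addrA; apply: memv_add.
    by rewrite linearZl_LR linearZr_LR !memvZ // memv_line.
  by apply: rpredD; [rewrite linearZl_LR memvZ ?bJ2J4 | apply: mem_jpowerS].
have decomp3 x : x \in jpower m 3 -> exists k u, u \in jpower m 4 /\ x = k *: c + u.
  move=> /(subvP sJ3).
  by case/memv_addP=> [_ /vlineP[k ->] [u uJ ->]]; exists k, u.
(* The Jordan identity gives a^2 (ab) = a (a^2 b) = a d, and d lies in J^<4>. *)
have bc : m b c = 0.
  by rewrite /c (mC b a) mJ xJ4.
have cc : m c c = 0.
  (* At a + b and b the left side of the Jordan identity is 2 c^2, and the right side is (a + b) e =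
     0 because e lies in J^<4>. *)
  have := mJ (a + b) b; pose e := m b b.
  have -> : m (a + b) b = c + e by rewrite linearDl (mC a b).
  have -> : m (a + b) (a + b) = b + (c + c) + e.
    by rewrite linearDl !linearDr (mC a b) /= -/b -/c -/e !addrA.
  have -> : m (b + (c + c) + e) b = e.
    by rewrite !linearDl (mC c b) bc [m e b]J4x // !addr0.
  have -> : m (b + (c + c) + e) (c + e) = 2%:R *: m c c.
    rewrite linearDr [m _ e]xJ4 // addr0 !linearDl bc [m e c]J4x //.
    by rewrite add0r addr0 scaler_nat mulr2n.
  by rewrite [m _ e]xJ4 // => /eqP; rewrite scaler_eq0 (negPf two_neq0) => /eqP.
(* Modulo J^<4>, which annihilates, J^<3> is spanned by c; and c sends a to d and b, c to zero. *)
have sJ4 : (jpower m 4 <= <[d]>)%VS.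
  apply/prodspP => u w uJ _; have [k [u4 [u4J ->]]] := decomp3 u uJ.
  have [l [w2 [w2J ->]]] := decomp w.
  rewrite linearDl [m u4 _]J4x // addr0 linearZl_LR linearDr linearZr_LR.
  have [k' [w3 [w3J ->]]] := decomp2 w2 w2J.
  have [k'' [w4 [w4J ->]]] := decomp3 w3 w3J.
  rewrite !linearDr !linearZr_LR cc (mC c b) bc [m c w4]xJ4 // !scaler0 !addr0.
  by rewrite !memvZ // memv_line.
apply: (@isomorphic_J11 a b c d) => //.
- apply: basis4 => //; rewrite {1}span_a addvS // (subv_trans sJ2) // addvS //.
  by rewrite (subv_trans sJ3) // addvS.
- by move=> x; apply: xJ4.
Qed.

End NilpotentJordan.

Theorem theorem6p1 (F : closedFieldType) (char_neq2 : 2%N \notin [pchar F]) :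
  [/\ (forall n : nat, (1 <= n <= 13)%N ->
         is_jordan (J4 F n) /\ is_nilpotent (J4 F n)),
      (forall n : nat, (1 <= n <= 13)%N ->
         (n \in [:: 1; 2; 3; 4; 5; 7; 11; 12; 13]%N -> is_assoc (J4 F n)) /\
         (n \in [:: 6; 8; 9; 10]%N -> ~ is_assoc (J4 F n))),
      (forall (V : vectType F) (m : {bilinear V -> V -> V}),
         \dim {:V} = 4%N -> is_jordan m -> is_nilpotent m ->
         exists2 n : nat, (1 <= n <= 13)%N & isomorphic m (J4 F n))
    & (forall i j : nat, (1 <= i <= 13)%N -> (1 <= j <= 13)%N -> i != j ->
         ~ isomorphic (J4 F i) (J4 F j))].
Proof.
have two_neq0 : (2%:R : F) != 0.
  by apply: contra char_neq2 => two0; rewrite inE.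
have square_root (p : F) : exists x, p = x * x.
  (* A root of the monic equation X^2 = p + 0 X. *)
  have [x xE] := solve_monicpoly (fun i => if i == 0%N then p else 0) (isT : 0 < 2)%N.
  by exists x; rewrite -expr2 xE !big_ord_recl big_ord0 /= mul0r mulr1 !addr0.
split=> [n len | n len | V m dimV jordan_m nil_m | i j lei lej].
- by split; [apply: J4_jordan | apply: J4_nilpotent].
- by split; [apply: J4_assoc | apply: J4_not_assoc].
- have dimJ2 := jpower_dimS 0 nil_m; rewrite dimV in dimJ2.
  have [dimJ2_le1 | dimJ2_gt1] := leqP (\dim (jpower m 2)) 1.
    have [p [q [r [s [t [w iso_m]]]]]] :=
      isomorphic_tri_mul_dim_le1 dimV jordan_m nil_m dimJ2_le1.
    exact: listed_isomorphic iso_m (listed_center two_neq0 square_root _ _ _ _ _ _).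
  have [dimJ2_2 | dimJ2_neq2] := eqVneq (\dim (jpower m 2)) 2%N.
    have [p1 [p2 [q1 [q2 [r1 [r2 [s [t [w [deg iso_m]]]]]]]]]] :=
      isomorphic_tri_mul_dim2 dimV jordan_m nil_m two_neq0 dimJ2_2.
    exact: listed_isomorphic iso_m (listed_tri_mul two_neq0 square_root _ _ _ _ _ deg).
  exists 11%N => //; apply: isomorphic_J11_dim3 => //.
  by move: dimJ2 dimJ2_gt1 dimJ2_neq2; rewrite /=; lia.
- by move=> nij /(J4_isomorphic_eq two_neq0 lei lej) eq_ij; rewrite eq_ij eqxx in nij.
Qed.
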